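(* Let $(N^3,g)$ be a three-dimensional Riemannian manifold with a unit vector field $\xi$ that is parallel with respect to the Levi-Civita connection $\nabla$, and let $\widehat{\nabla}$ be the semi-symmetric non-metric connection on $N^3$ with associated vector field $\xi$, i.e. $\widehat{\nabla}_UV=\nabla_UV+g(V,\xi)U$. Suppose $g$ is a gradient Yamabe soliton with respect to $\widehat{\nabla}$, with potential function $f$ and constant $\lambda\in\mathbb{R}$. Then either $N^3$ is a manifold of constant scalar curvature (i.e. $\widehat{r}$ is constant) or the gradient Yamabe soliton is trivial with respect to $\widehat{\nabla}$.
   Context: $\nabla$ is the Levi-Civita connection of $g$ and $\psi$ is the $1$-form $\psi(U)=g(U,\xi)$. It is a standing assumption that $\xi$ is a unit vector field with $\nabla_U\xi=0$ for all $U$. The curvature of $\widehat{\nabla}$ is $\widehat{R}(U,V)Y=\widehat{\nabla}_U\widehat{\nabla}_VY-\widehat{\nabla}_V\widehat{\nabla}_UY-\widehat{\nabla}_{[U,V]}Y$, its Ricci tensor is $\widehat{\mathcal{S}}(V,Y)=\mathrm{trace}(U\mapsto\widehat{R}(U,V)Y)$, and its scalar curvature $\widehat{r}$ is the $g$-trace of $\widehat{\mathcal{S}}$. $Df$ is the gradient of $f$ with respect to $g$, and $\widehat{\nabla}^2f(U,V)=g(\widehat{\nabla}_UDf,V)$. The metric $g$ is a gradient Yamabe soliton (with respect to $\widehat{\nabla}$) if there are a smooth function $f$ and a real constant $\lambda$ with $\widehat{\nabla}^2f-(\widehat{r}-\lambda)g=0$. The soliton is trivial if $f$ is constant (or $W=Df$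 is Killing). *)

(* Defs.v *)
From HB Require Import structures.
From mathcomp Require Import all_boot all_order all_algebra.
From mathcomp Require Import all_classical all_reals all_analysis.

Set Implicit Arguments.
Unset Strict Implicit.
Unset Printing Implicit Defensive.

Import Order.TTheory GRing.Theory Num.Theory numFieldNormedType.Exports.
Local Open Scope classical_set_scope.
Local Open Scope ring_scope.

Section CkOn.
Context {R : realType} {n : nat}.
Implicit Types (U : set 'rV[R]_n) (f g : 'rV[R]_n -> R) (k : nat).

(* All iterated partial derivatives of [f] of order at most [k] exist and are
   continuous on [U], which is always open below. *)
Fixpoint Ck_on U k f : Prop :=
  (forall x, U x -> {for x, continuous f}) /\
  match k with
  | 0 => True
  | k'.+1 => forall i : 'I_n,
      (forall x, U x -> derivable f x (delta_mx 0 i)) /\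
      Ck_on U k' ('D_(delta_mx 0 i) f)
  end.

Definition Cinf_on U f : Prop := forall k, Ck_on U k f.

Lemma Ck_on_cont U k f : Ck_on U k f -> forall x, U x -> {for x, continuous f}.
Proof. by case: k => [|k] []. Qed.

Lemma Ck_onW U k f : Ck_on U k.+1 f -> Ck_on U k f.
Proof.
elim: k f => [|k IH] f; first by case.
by case=> cf df; split=> // i; have [di /IH] := df i.
Qed.

Lemma Ck_on_ext U k f g : open U -> (forall x, U x -> f x = g x) ->
  Ck_on U k f -> Ck_on U k g.
Proof.
move=> oU; have nfg f1 g1 x : (forall x, U x -> f1 x = g1 x) -> U x ->
    \near x, f1 x = g1 x.
  move=> fg Ux; have : nbhs x U by apply: open_nbhs_nbhs.
  by apply: filterS => y /fg.
have cont f1 g1 : (forall x, U x -> f1 x = g1 x) ->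
    (forall x, U x -> {for x, continuous f1}) ->
    forall x, U x -> {for x, continuous g1}.
  move=> fg cf x Ux; rewrite /prop_for /continuous_at -fg//.
  have h := nfg _ _ _ fg Ux.
  have gf : g1 @ x `=>` f1 @ x by exact: (near_eq_cvg h).
  exact: cvg_trans gf (cf x Ux).
elim: k f g => [|k IH] f g fg [cf df]; split=> //; try exact: cont cf.
move=> i; have [di Di] := df i; split.
  move=> x Ux; exact: near_eq_derivable (nfg _ _ _ fg Ux) (di x Ux).
apply: IH Di => x Ux; apply: near_eq_derive; exact: nfg.
Qed.

Lemma Ck_on_cst U k (a : R) : Ck_on U k (cst a).
Proof.
elim: k a => [|k IH] a; split=> //; try by move=> x _; exact: cst_continuous.
move=> i; split; first by move=> x _; exact: derivable_cst.
rewrite (_ : 'D_(delta_mx 0 i) (cst a) = cst 0); first exact: IH.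
by apply/funext => x; rewrite derive_cst.
Qed.

Lemma Ck_onD U k f g : open U -> Ck_on U k f -> Ck_on U k g ->
  Ck_on U k (f + g).
Proof.
move=> oU; elim: k f g => [|k IH] f g [cf df] [cg dg].
  by split=> // x Ux; apply: continuousD; [exact: cf|exact: cg].
split; first by move=> x Ux; apply: continuousD; [exact: cf|exact: cg].
move=> i; have [fi Fi] := df i; have [gi Gi] := dg i; split.
  by move=> x Ux; apply: derivableD; [exact: fi|exact: gi].
apply: Ck_on_ext (IH _ _ Fi Gi) => // x Ux.
by rewrite deriveD; [|exact: fi|exact: gi].
Qed.

Lemma Ck_onM U k f g : open U -> Ck_on U k f -> Ck_on U k g ->
  Ck_on U k (f * g).
Proof.
move=> oU; elim: k f g => [|k IH] f g hf hg.
  split=> // x Ux; apply: continuousM; [exact: hf.1|exact: hg.1].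
have [[cf df] [cg dg]] := (hf, hg).
split; first by move=> x Ux; apply: continuousM; [exact: cf|exact: cg].
move=> i; have [fi Fi] := df i; have [gi Gi] := dg i; split.
  by move=> x Ux; apply: derivableM; [exact: fi|exact: gi].
have h := Ck_onD oU (IH _ _ (Ck_onW hf) Gi) (IH _ _ (Ck_onW hg) Fi).
apply: Ck_on_ext h => // x Ux.
by rewrite deriveM; [|exact: fi|exact: gi].
Qed.

End CkOn.

(* A chart with values in R^n; [chart_inv] is meaningful on [chart_img]. *)
Record chart (R : realType) (n : nat) (T : topologicalType) := Chart {
  chart_dom : set T;
  chart_img : set 'rV[R]_n;
  chart_map : T -> 'rV[R]_n;
  chart_inv : 'rV[R]_n -> T;
  chart_dom_open : open chart_dom;
  chart_img_open : open chart_img;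
  chart_map_img : forall p, chart_dom p -> chart_img (chart_map p);
  chart_inv_dom : forall x, chart_img x -> chart_dom (chart_inv x);
  chart_mapK : forall p, chart_dom p -> chart_inv (chart_map p) = p;
  chart_invK : forall x, chart_img x -> chart_map (chart_inv x) = x;
  chart_map_cont : {within chart_dom, continuous chart_map};
  chart_inv_cont : {within chart_img, continuous chart_inv}
}.

(* Not assumed connected. *)
Record smoothManifold (R : realType) (n : nat) := SmoothManifold {
  man_top :> topologicalType;
  man_hausdorff : hausdorff_space man_top;
  man_second_countable : @second_countable man_top;
  man_atlas : set (chart R n man_top);
  man_cover : forall p, exists2 c, man_atlas c & chart_dom c p;
  man_compat : forall c d, man_atlas c -> man_atlas d -> forall j : 'I_n,
    Cinf_on (chart_img c `&` chart_inv c @^-1` chart_dom d)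
            (fun x => chart_map d (chart_inv c x) 0 j)
}.

Section SmoothFunctions.
Context {R : realType} {n : nat} (M : smoothManifold R n).

Definition smooth (f : M -> R) : Prop :=
  forall c, man_atlas c -> Cinf_on (chart_img c) (f \o chart_inv c).

Definition smooth_pred : {pred M -> R} := [pred f | `[< smooth f >]].

Lemma smooth_subring : subring_closed smooth_pred.
Proof.
have smN1 : smooth (-1 : M -> R) by move=> c _ k; exact: (Ck_on_cst _ _ (-1)).
have smM f g : smooth f -> smooth g -> smooth (f * g).
  by move=> sf sg c ac k; apply: (Ck_onM (@chart_img_open _ _ _ c));
    [exact: sf|exact: sg].
have smD f g : smooth f -> smooth g -> smooth (f + g).
  by move=> sf sg c ac k; apply: (Ck_onD (@chart_img_open _ _ _ c));
    [exact: sf|exact: sg].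
split.
- by apply/asboolP => c _ k; exact: (Ck_on_cst _ _ 1).
- move=> f g /asboolP sf /asboolP sg; apply/asboolP.
  by rewrite -mulN1r; apply: smD => //; apply: smM.
- by move=> f g /asboolP sf /asboolP sg; apply/asboolP; exact: smM.
Qed.

Lemma smooth_scale : GRing.scaler_closed smooth_pred.
Proof.
move=> a f /asboolP sf; apply/asboolP => c ac k.
by apply: (Ck_onM (@chart_img_open _ _ _ c) (Ck_on_cst _ _ a)); exact: sf.
Qed.

HB.instance Definition _ :=
  GRing.isSubringClosed.Build (M -> R) smooth_pred smooth_subring.
HB.instance Definition _ :=
  GRing.isScaleClosed.Build R (M -> R) smooth_pred smooth_scale.

(* The algebra of smooth real functions on M. *)
Record Cinf := MkCinf {
  Cinf_val :> M -> R;
  Cinf_valP : Cinf_val \in smooth_pred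
}.

HB.instance Definition _ := [isSub for Cinf_val].
HB.instance Definition _ := [Choice of Cinf by <:].
HB.instance Definition _ := GRing.SubChoice_isSubComPzRing.Build (M -> R) smooth_pred Cinf (GRing.subringClosedP smooth_pred).
HB.instance Definition _ := [SubZmodule_isSubLmodule of Cinf by <:].

End SmoothFunctions.

Section VectorFields.
Context {R : realType} {n : nat} (M : smoothManifold R n).

(* Smooth vector fields, as derivations of the algebra of smooth functions. *)
Record vfield := VField {
  vfield_fun :> Cinf M -> Cinf M;
  vfield_linear : linear vfield_fun;
  vfield_leibniz : forall f h,
    vfield_fun (f * h) = vfield_fun f * h + f * vfield_fun h
}.

Lemma vfieldP (X Y : vfield) : (forall f, X f = Y f) <-> X = Y.
Proof.
split=> [|-> //]; case: X Y => [X X1 X2] [Y Y1 Y2] /= /funext XY.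
by subst Y; congr VField; exact: Prop_irrelevance.
Qed.

HB.instance Definition _ := gen_eqMixin vfield.
HB.instance Definition _ := gen_choiceMixin vfield.

Program Definition vfield_zero := @VField (fun=> 0) _ _.
Next Obligation. by move=> a f h /=; rewrite scaler0 addr0. Qed.
Next Obligation. by move=> f h /=; rewrite mul0r mulr0 addr0. Qed.

Program Definition vfield_add (X Y : vfield) :=
  @VField (fun f => X f + Y f) _ _.
Next Obligation.
by move=> X Y a f h /=; rewrite !vfield_linear scalerDr addrACA.
Qed.
Next Obligation.
by move=> X Y f h /=; rewrite !vfield_leibniz mulrDl mulrDr addrACA.
Qed.

Lemma Cinf_scaleAl (a : R) (f h : Cinf M) : a *: (f * h) = (a *: f) * h.
Proof. by apply/val_inj/funext => p; exact: (mulrA a (f p) (h p)). Qed.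

Lemma Cinf_scaleAr (a : R) (f h : Cinf M) : a *: (f * h) = f * (a *: h).
Proof. by rewrite mulrC Cinf_scaleAl mulrC. Qed.

Program Definition vfield_scale (u : Cinf M) (X : vfield) :=
  @VField (fun f => u * X f) _ _.
Next Obligation.
by move=> u X a f h /=; rewrite vfield_linear mulrDr Cinf_scaleAr.
Qed.
Next Obligation.
by move=> u X f h /=; rewrite vfield_leibniz mulrDr mulrA (mulrCA u).
Qed.

Program Definition vfield_opp (X : vfield) := @VField (fun f => - X f) _ _.
Next Obligation.
by move=> X a f h /=; rewrite vfield_linear opprD scalerN.
Qed.
Next Obligation.
by move=> X f h /=; rewrite vfield_leibniz opprD mulNr mulrN.
Qed.

Lemma vfield_addA : associative vfield_add.
Proof. by move=> X Y Z; apply/vfieldP => f /=; rewrite addrA. Qed.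
Lemma vfield_addC : commutative vfield_add.
Proof. by move=> X Y; apply/vfieldP => f /=; rewrite addrC. Qed.
Lemma vfield_add0 : left_id vfield_zero vfield_add.
Proof. by move=> X; apply/vfieldP => f /=; rewrite add0r. Qed.
Lemma vfield_addN : left_inverse vfield_zero vfield_opp vfield_add.
Proof. by move=> X; apply/vfieldP => f /=; rewrite addNr. Qed.

HB.instance Definition _ := GRing.isZmodule.Build vfield
  vfield_addA vfield_addC vfield_add0 vfield_addN.

Lemma vfield_scaleA (u v : Cinf M) (X : vfield) :
  vfield_scale u (vfield_scale v X) = vfield_scale (u * v) X.
Proof. by apply/vfieldP => f /=; rewrite mulrA. Qed.
Lemma vfield_scale1 : left_id 1 vfield_scale.
Proof. by move=> X; apply/vfieldP => f /=; rewrite mul1r. Qed.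
Lemma vfield_scaleDr : right_distributive vfield_scale +%R.
Proof. by move=> u X Y; apply/vfieldP => f /=; rewrite mulrDr. Qed.
Lemma vfield_scaleDl (X : vfield) :
  {morph vfield_scale^~ X : u v / u + v >-> u + v}.
Proof. by move=> u v; apply/vfieldP => f /=; rewrite mulrDl. Qed.

HB.instance Definition _ := GRing.Zmodule_isLmodule.Build (Cinf M) vfield
  vfield_scaleA vfield_scale1 vfield_scaleDr vfield_scaleDl.

Program Definition lie (X Y : vfield) : vfield :=
  @VField (fun f => X (Y f) - Y (X f)) _ _.
Next Obligation.
by move=> X Y a f h /=; rewrite !vfield_linear scalerBr opprD addrACA.
Qed.
Next Obligation.
move=> X Y f h /=; rewrite !vfield_leibniz.
have vD (Z : vfield) a b : Z (a + b) = Z a + Z b.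
  by have := vfield_linear Z 1 a b; rewrite !scale1r.
rewrite !vD !vfield_leibniz.
have sub (a b c d a' d' : Cinf M) :
    a + b + (c + d) - (a' + c + (b + d')) = a - a' + (d - d').
  rewrite !opprD !addrA (ACl (1*5*4*8*(2*7)*(3*6)))/=.
  by rewrite !subrr !addr0.
by rewrite sub mulrBl mulrBr.
Qed.

(* The value of X at p: the tangent vector f |-> (X f)(p). *)
Definition vfield_at (X : vfield) (p : M) : Cinf M -> R := fun f => X f p.

Definition tangent_basis (E : 'I_n -> vfield) (p : M) : Prop :=
  forall X : vfield, exists! c : 'rV[R]_n,
    vfield_at X p = \sum_i c 0 i *: vfield_at (E i) p.

(* [t] is the trace at [p] of a tensorial [A], i.e. the trace of its matrix in
   a basis of the tangent space at [p].  Such a basis always exists, and [t]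
   does not depend on it. *)
Definition is_trace_at (A : vfield -> vfield) (p : M) (t : R) : Prop :=
  exists (E : 'I_n -> vfield) (a : 'M[R]_n),
    [/\ tangent_basis E p,
        forall j, vfield_at (A (E j)) p = \sum_i a i j *: vfield_at (E i) p
      & t = \tr a].

(* A (0,2)-tensor field that is an inner product on each tangent space.
   The right-to-left part of [metric_eq0] holds for any tensor field, whose
   value at [p] only depends on the arguments at [p]. *)
Record riemannian_metric := RiemannianMetric {
  metric_fun :> vfield -> vfield -> Cinf M;
  metric_linear : forall u X Y Z,
    metric_fun (u *: X + Y) Z = u * metric_fun X Z + metric_fun Y Z;
  metric_sym : forall X Y, metric_fun X Y = metric_fun Y X;
  metric_ge0 : forall X p, 0 <= metric_fun X X p;
  metric_eq0 : forall X p, metric_fun X X p = 0 <-> vfield_at X p = 0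
}.

Record is_connection (D : vfield -> vfield -> vfield) : Prop := IsConnection {
  connection_linear : forall u X Y Z, D (u *: X + Y) Z = u *: D X Z + D Y Z;
  connection_add : forall X Y Z, D X (Y + Z) = D X Y + D X Z;
  connection_leibniz : forall (X : vfield) (u : Cinf M) (Y : vfield),
    D X (u *: Y) = X u *: Y + u *: D X Y
}.

Record is_levi_civita (g : riemannian_metric)
    (D : vfield -> vfield -> vfield) : Prop := IsLeviCivita {
  levi_civita_connection : is_connection D;
  levi_civita_torsion : forall X Y : vfield, D X Y - D Y X = lie X Y;
  levi_civita_metric : forall X Y Z : vfield,
    X (g Y Z) = g (D X Y) Z + g Y (D X Z)
}.

(* The semi-symmetric non-metric connection associated with xi. *)
Definition semisym_nonmetric (g : riemannian_metric)
    (D : vfield -> vfield -> vfield) (xi U V : vfield) : vfield :=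
  D U V + g V xi *: U.

Definition curvature (D : vfield -> vfield -> vfield)
    (U V Y : vfield) : vfield :=
  D U (D V Y) - D V (D U Y) - D (lie U V) Y.

Definition is_ricci_tensor (D : vfield -> vfield -> vfield)
    (S : vfield -> vfield -> M -> R) : Prop :=
  forall V Y p, is_trace_at (fun U => curvature D U V Y) p (S V Y p).

(* The trace of S with respect to g, computed in an orthonormal basis at each
   point. *)
Definition is_metric_trace (g : riemannian_metric)
    (S : vfield -> vfield -> M -> R) (r : M -> R) : Prop :=
  forall p, exists E : 'I_n -> vfield,
    [/\ tangent_basis E p,
        forall i j, g (E i) (E j) p = (i == j)%:R
      & r p = \sum_i S (E i) (E i) p].

Definition is_scalar_curvature (g : riemannian_metric)
    (D : vfield -> vfield -> vfield) (r : M -> R) : Prop :=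
  exists2 S, is_ricci_tensor D S & is_metric_trace g S r.

Definition is_gradient (g : riemannian_metric) (f : Cinf M) (W : vfield) :
    Prop :=
  forall V : vfield, g W V = V f.

(* [W] is the gradient of [f] and [r] the scalar curvature of [D]. *)
Definition gradient_yamabe_soliton (g : riemannian_metric)
    (D : vfield -> vfield -> vfield) (f : Cinf M) (W : vfield)
    (r : M -> R) (lambda : R) : Prop :=
  [/\ is_gradient g f W,
      is_scalar_curvature g D r
    & forall U V p, g (D U W) V p - (r p - lambda) * g U V p = 0].

(* The Lie derivative of g along W vanishes. *)
Definition killing (g : riemannian_metric) (W : vfield) : Prop :=
  forall U V, W (g U V) = g (lie W U) V + g U (lie W V).

Definition trivial_soliton (g : riemannian_metric) (f : Cinf M) (W : vfield) :
    Prop :=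
  (exists c : R, forall p, f p = c) \/ killing g W.

End VectorFields.

(* Main.v *)
(* Put W = Df and h = g(nabla_xi W, xi).  The soliton equation says
   nabla_U W = h U and r = lambda + h + xi(f), so R(U,V)W = U(h)V - V(h)U.
   As R(.,.)xi = 0, pair symmetry gives R(xi,.) = 0, whence dh = 0, and therefore
   xi(r) = h.  The component T of W orthogonal to xi satisfies
   nabla_U T = h (U - g(U,xi)xi) and R(.,.)T = 0.  In dimension three a curvature
   tensor annihilating the orthogonal fields xi and T vanishes wherever T does
   not; since r - 2 is the scalar curvature of nabla, |T|^2 (r - 2) = 0.
   Differentiating along xi gives h |T|^2 = 0, and differentiating twice more
   gives h^3 = 0.  So W is parallel, hence Killing, on the whole manifold, which
   need not be connected. *)
From Pilot Require Import Defs.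
From HB Require Import structures.
From mathcomp Require Import all_boot all_order all_algebra.
From mathcomp Require Import all_classical all_reals all_analysis.
From mathcomp Require Import ring lra.
Set Implicit Arguments.
Unset Strict Implicit.
Unset Printing Implicit Defensive.
Import Order.TTheory GRing.Theory Num.Theory.
(* mathcomp-analysis has its own [metric_sym]. *)
Import Pilot.Defs.
Local Open Scope ring_scope.

(** * Pointwise calculus of smooth functions and derivations *)

Section Fields.
Context {R : realType} {n : nat} {M : smoothManifold R n}.
Implicit Types (u v : Cinf M) (X Y Z : vfield M).

Lemma CinfE :
  ((forall u v p, (u + v : Cinf M) p = u p + v p) *
   (forall u v p, (u * v : Cinf M) p = u p * v p)) *
  ((forall u p, (- u : Cinf M) p = - u p) *
   ((forall p, (0 : Cinf M) p = 0) * (forall p, (1 : Cinf M) p = 1))).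
Proof. by []. Qed.

Lemma CinfP u v : (forall p, u p = v p) -> u = v.
Proof. by move=> uv; apply/val_inj/funext. Qed.

Lemma Cinf_cstE (c : R) p : (c *: (1 : Cinf M)) p = c.
Proof. exact: mulr1. Qed.

Lemma vfieldE :
  ((forall X Y u, (X + Y : vfield M) u = X u + Y u) *
   (forall X u, (- X : vfield M) u = - X u)) *
  ((forall u X v, (u *: X : vfield M) v = u * X v) *
   (forall u, (0 : vfield M) u = 0)).
Proof. by []. Qed.

Lemma lieE X Y u : lie X Y u = X (Y u) - Y (X u).
Proof. by []. Qed.

Lemma vfield_fD X u v : X (u + v) = X u + X v.
Proof. by have := vfield_linear X 1 u v; rewrite !scale1r. Qed.

Lemma vfield_f0 X : X 0 = 0.
Proof. by apply: (addrI (X 0)); rewrite -vfield_fD !addr0. Qed.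

Lemma vfield_fN X u : X (- u) = - X u.
Proof. by apply: (addrI (X u)); rewrite -vfield_fD !subrr vfield_f0. Qed.

Lemma vfield_fM X u v : X (u * v) = X u * v + u * X v.
Proof. exact: vfield_leibniz. Qed.

Lemma vfield_f1 X : X 1 = 0.
Proof.
by apply: (addrI (X 1)); have := vfield_fM X 1 1; rewrite !mulr1 mul1r addr0.
Qed.

Lemma vfield_cst X (c : R) : X (c *: (1 : Cinf M)) = 0.
Proof.
by have := vfield_linear X c 1 0; rewrite !addr0 vfield_f1 vfield_f0 scaler0 addr0.
Qed.

End Fields.

(** * The metric and its dependence on values at a point *)

Section Metric.
Context {R : realType} {n : nat} {M : smoothManifold R n}.
Variable g : riemannian_metric M.
Implicit Types (u v : Cinf M) (X Y Z : vfield M) (p : M).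

Lemma metricDl X Y Z : g (X + Y) Z = g X Z + g Y Z.
Proof. by have := metric_linear g 1 X Y Z; rewrite scale1r mul1r. Qed.

Lemma metric0l Z : g 0 Z = 0.
Proof. by apply: (addrI (g 0 Z)); rewrite -metricDl !addr0. Qed.

Lemma metricZl u X Z : g (u *: X) Z = u * g X Z.
Proof. by have := metric_linear g u X 0 Z; rewrite metric0l !addr0. Qed.

Lemma metricNl X Z : g (- X) Z = - g X Z.
Proof. by apply: (addrI (g X Z)); rewrite -metricDl !subrr metric0l. Qed.

Lemma metricDr X Y Z : g Z (X + Y) = g Z X + g Z Y.
Proof. by rewrite !(metric_sym g Z) metricDl. Qed.

Lemma metric0r Z : g Z 0 = 0.
Proof. by rewrite metric_sym metric0l. Qed.

Lemma metricZr u X Z : g Z (u *: X) = u * g Z X.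
Proof. by rewrite !(metric_sym g Z) metricZl. Qed.

Lemma metricNr X Z : g Z (- X) = - g Z X.
Proof. by rewrite !(metric_sym g Z) metricNl. Qed.

Definition metricE := (metricDl, metricDr, metricNl, metricNr,
  (metricZl, metricZr, metric0l, metric0r)).

Lemma metric_inj X Y : (forall Z, g X Z = g Y Z) -> X = Y.
Proof.
move=> XY; apply/eqP; rewrite -subr_eq0; apply/eqP/vfieldP => f.
apply/CinfP => p; rewrite -[LHS]/(vfield_at (X - Y) p f).
by have /metric_eq0-> // : g (X - Y) (X - Y) p = 0;
  rewrite metricDl metricNl XY subrr.
Qed.

(* Cauchy-Schwarz at [p]: [g (c X + Z) (c X + Z) p] would be negative for the
   constant [c] below. *)
Lemma metric_at0 X Z p : vfield_at X p = 0 -> g X Z p = 0.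
Proof.
move=> /metric_eq0 X0; apply/eqP; apply: contraT => b0.
pose c : R := - (g Z Z p + 1) / (2 * g X Z p).
have := metric_ge0 g ((c *: (1 : Cinf M)) *: X + Z) p.
rewrite !metricE (metric_sym g Z X) !CinfE !Cinf_cstE X0.
suff -> : c * (c * 0 + g X Z p) + (c * g X Z p + g Z Z p) = -1 by rewrite ler0N1.
by rewrite /c; field.
Qed.

Lemma metric_at X Y Z p : vfield_at X p = vfield_at Y p -> g X Z p = g Y Z p.
Proof.
move=> XY; have : vfield_at (X - Y) p = 0.
  apply/funext => f; have /(congr1 (fun F => F f)) := XY.
  rewrite /vfield_at !vfieldE !CinfE => ->; exact: subrr.
move/metric_at0 => /(_ Z); rewrite !metricE CinfE => /eqP.
by rewrite subr_eq0 => /eqP.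
Qed.

Lemma metric_at_sum (E : 'I_n -> vfield M) (c : 'I_n -> R) X Z p :
  vfield_at X p = \sum_i c i *: vfield_at (E i) p ->
  g X Z p = \sum_i c i * g (E i) Z p.
Proof.
(* Constant coefficients make the combination at [p] a global field with the same value there as
   [X]. *)
pose Y := \sum_i ((c i *: (1 : Cinf M)) *: E i).
move=> XE; rewrite (@metric_at X Y).
  rewrite /Y; elim/big_ind2: _ => [|a b d e Ha He|i _].
  - by rewrite metric0l.
  - by rewrite metricDl CinfE Ha He.
  - by rewrite metricZl CinfE Cinf_cstE.
rewrite XE /Y; elim/big_ind2: _ => // [a b d e -> ->|i _]; first exact/funext.
by apply/funext => f; rewrite /vfield_at vfieldE CinfE Cinf_cstE.
Qed.

End Metric.

(** * Curvature symmetries and the semi-symmetric connection *)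

Section Connection.
Context {R : realType} {n : nat} {M : smoothManifold R n}.
Variables (g : riemannian_metric M) (D : vfield M -> vfield M -> vfield M).
Hypothesis hD : is_levi_civita g D.
Implicit Types (u v : Cinf M) (U V X Y Z : vfield M) (p : M).

Let cD := levi_civita_connection hD.

Lemma connDl X Y Z : D (X + Y) Z = D X Z + D Y Z.
Proof. by have := connection_linear cD 1 X Y Z; rewrite !scale1r. Qed.

Lemma conn0r X : D X 0 = 0.
Proof. by apply: (addrI (D X 0)); rewrite -(connection_add cD) !addr0. Qed.

Lemma connNr X Y : D X (- Y) = - D X Y.
Proof. by apply: (addrI (D X Y)); rewrite -(connection_add cD) !subrr conn0r. Qed.

Lemma conn0l X : D 0 X = 0.
Proof. by apply: (addrI (D 0 X)); rewrite -connDl !addr0. Qed.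

Lemma connNl X Y : D (- X) Y = - D X Y.
Proof. by apply: (addrI (D X Y)); rewrite -connDl !subrr conn0l. Qed.

Lemma lieC X Y : lie X Y = - lie Y X.
Proof. by apply/vfieldP => f; rewrite vfieldE !lieE opprB. Qed.

Lemma curvature_alt U V Y : curvature D U V Y = - curvature D V U Y.
Proof.
apply/vfieldP => f; rewrite /curvature (lieC U V) connNl !vfieldE; ring.
Qed.

(** Metric compatibility expands the action of [U,V] on g(Y,Z); mixed terms such as g(D_U Y, D_V Z)
    cancel. *)
Lemma curvature_metric U V Y Z :
  g (curvature D U V Y) Z = - g (curvature D U V Z) Y.
Proof.
have gD := levi_civita_metric hD.
have := lieE U V (g Y Z).
rewrite !gD !vfield_fD !gD /curvature !metricE (metric_sym g _ Y) => e.
rewrite ![in RHS](metric_sym g _ Y).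
apply/eqP; rewrite -subr_eq0; apply/eqP; move/eqP: e; rewrite -subr_eq0 => /eqP e.
by rewrite -[RHS]oppr0 -e; ring.
Qed.

Lemma first_bianchi U V Y :
  curvature D U V Y + curvature D V Y U + curvature D Y U V = 0.
Proof.
have tD := levi_civita_torsion hD.
(* Vanishing torsion is used twice, on (B,C) and on (A,[B,C]). In the cyclic sum only the Jacobi
   identity then remains. *)
have tw A B C : D A (D B C) = D A (D C B) + D (lie B C) A + lie A (lie B C).
  rewrite -addrA [D (lie _ _) _ + _]addrC -tD subrK.
  by rewrite -(connection_add cD) -tD addrC subrK.
rewrite /curvature (tw U V Y) (tw V Y U) (tw Y U V).
by apply/vfieldP => f; rewrite !vfieldE !lieE !vfield_fD !vfield_fN; ring.
Qed.

Lemma curvature_pair U V Y Z :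
  g (curvature D U V Y) Z = g (curvature D Y Z U) V.
Proof.
apply/CinfP => p.
pose F (A B C E : vfield M) := g (curvature D A B C) E p.
have alt A B C E : F A B C E = - F B A C E.
  by rewrite /F curvature_alt metricNl CinfE.
have met A B C E : F A B C E = - F A B E C by rewrite /F curvature_metric CinfE.
have bia A B C E : F A B C E + F B C A E + F C A B E = 0.
  by rewrite /F -!CinfE -!metricDl first_bianchi metric0l CinfE.
rewrite -/(F U V Y Z) -/(F Y Z U V).
(* Four Bianchi identities suffice; the antisymmetries listed next identify their terms up to
   sign. *)
have := (bia U V Y Z, bia V Y Z U, bia Y Z U V, bia Z U V Y).
have := (met Y U V Z, met V U Y Z, met Z V Y U).
have := (alt Y Z V U, alt U Y V Z).
have := (met U V Z Y, met V Y Z U, met Y Z V U, met Z U Y V, alt Z U V Y).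
have := (met V Y U Z, met Y Z U V, met Z U V Y, alt V Z Y U, met V Z U Y).
have := (met Y U Z V, alt Y U Z V, met U Y Z V, alt Z V U Y).
case=> [[[? ?] ?] ?] [[[[? ?] ?] ?] ?] [[[[? ?] ?] ?] ?] [? ?] [[? ?] ?] [[[? ?] ?] ?].
lra.
Qed.

Variable xi : vfield M.
Hypothesis xi_parallel : forall U, D U xi = 0.

Lemma derive_parallel U Y : U (g Y xi) = g (D U Y) xi.
Proof. by rewrite (levi_civita_metric hD) xi_parallel metric0r addr0. Qed.

Lemma curvature_parallel U V : curvature D U V xi = 0.
Proof. by rewrite /curvature !xi_parallel !conn0r !subr0. Qed.

(** As [xi] is parallel, the first-derivative terms g(D_U Y,xi)V + g(D_V Y,xi)U are symmetric in U
    and V and drop out; vanishing torsion removes the [U,V] terms. *)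
Lemma semisym_curvature U V Y :
  curvature (semisym_nonmetric g D xi) U V Y =
  curvature D U V Y + g Y xi *: (g V xi *: U - g U xi *: V).
Proof.
rewrite /curvature /semisym_nonmetric -(levi_civita_torsion hD U V).
rewrite !(connection_add cD) !(connection_leibniz cD) !derive_parallel !metricE.
by apply/vfieldP => f; rewrite !vfieldE; ring.
Qed.

(* The pair symmetry moves [U] into a slot of the metric, where dependence on
   the value at a point only is [metric_at]; no cut-off functions are needed. *)
Lemma semisym_curvature_tensorial V Y Z : exists K, forall U,
  g (curvature (semisym_nonmetric g D xi) U V Y) Z = g U K.
Proof.
exists (- curvature D Y Z V + (g Y xi * g V xi) *: Z - (g Y xi * g V Z) *: xi).
move=> U; rewrite semisym_curvature metricDl curvature_pair curvature_metric.
by rewrite (metric_sym g _ U); move: (curvature _ _ _ _) => C; rewrite !metricE; ring.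
Qed.

End Connection.

(** * Orthonormal frames and traces at a point *)

Section Orthonormal.
Context {R : realType} {n : nat} {M : smoothManifold R n}.
Variables (g : riemannian_metric M) (p : M) (E : 'I_n -> vfield M).
Hypotheses (basE : tangent_basis E p)
  (orthE : forall i j, g (E i) (E j) p = (i == j)%:R).
Implicit Types (X Y Z : vfield M).

Lemma orthonormal_coord X :
  vfield_at X p = \sum_i g X (E i) p *: vfield_at (E i) p.
Proof.
have [c [Xc _]] := basE X; rewrite Xc; apply: eq_bigr => i _; congr (_ *: _).
rewrite (metric_at_sum g (E i) Xc) (bigD1 i)//= orthE eqxx mulr1 big1 ?addr0//.
by move=> j /negPf ji; rewrite orthE ji mulr0.
Qed.

Lemma parseval X Y : g X Y p = \sum_i g X (E i) p * g Y (E i) p.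
Proof.
rewrite (metric_at_sum g Y (orthonormal_coord X)).
by apply: eq_bigr => i _; rewrite (metric_sym g Y).
Qed.

(** The basis [F] behind [is_trace_at] is arbitrary, so this is a change of basis: [b] and [c] are
    the mutually inverse transition matrices and [m] is the matrix of [A] in [E]. *)
Lemma trace_orthonormal (A : vfield M -> vfield M) (t : R) :
  (forall Z, exists K, forall X, g (A X) Z = g X K) ->
  is_trace_at A p t -> t = \sum_i g (A (E i)) (E i) p.
Proof.
move=> tA [F [a [basF AF ->]]].
pose b := \matrix_(k, j) g (F j) (E k) p.
pose m := \matrix_(l, k) g (A (E k)) (E l) p.
have [c Ec] : exists c : 'M[R]_n,
    forall k, vfield_at (E k) p = \sum_i c i k *: vfield_at (F i) p.
  have /choice[c Ec] k : exists c : 'rV[R]_n,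
      vfield_at (E k) p = \sum_i c 0 i *: vfield_at (F i) p.
    by have [c [? _]] := basF (E k); exists c.
  exists (\matrix_(i, k) c k 0 i) => k; rewrite Ec.
  by apply: eq_bigr => i _; rewrite mxE.
have bc1 : b *m c = 1%:M.
  apply/matrixP => l k; rewrite !mxE eq_sym -orthE (metric_at_sum g _ (Ec k)).
  by apply: eq_bigr => i _; rewrite mxE mulrC.
have bamb : b *m a = m *m b.
  apply/matrixP => l j; rewrite !mxE.
  transitivity (g (A (F j)) (E l) p).
    rewrite (metric_at_sum g _ (AF j)).
    by apply: eq_bigr => i _; rewrite mxE mulrC.
  (* Moving [A] off its argument permits expanding [F j] in [E], an equality of values at [p]
     only. *)
  have [K tK] := tA (E l).
  rewrite tK (metric_at_sum g _ (orthonormal_coord (F j))).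
  by apply: eq_bigr => i _; rewrite !mxE tK mulrC.
transitivity (\tr m); last by apply: eq_bigr => i _; rewrite mxE.
rewrite -[m]mulmx1 -bc1 mulmxA -bamb -mulmxA mxtrace_mulC -mulmxA.
by rewrite (mulmx1C bc1) mulmx1.
Qed.

End Orthonormal.

(* [w] is the cross product with the vector [(c, -b, a)] of its entries, which is
   then parallel to both [x] and [t]. *)
Lemma antisym3_kernel (R : comPzRingType) (w : 'I_3 -> 'I_3 -> R) (x t : 'I_3 -> R) :
  (forall i, w i i = 0) -> (forall i j, w i j = - w j i) ->
  (forall i, \sum_j w i j * x j = 0) -> (forall i, \sum_j w i j * t j = 0) ->
  \sum_i x i * x i = 1 -> \sum_i x i * t i = 0 ->
  forall i j, (\sum_i t i * t i) * w i j = 0.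
Proof.
pose i0 : 'I_3 := ord0; pose i1 : 'I_3 := lift ord0 ord0.
pose i2 : 'I_3 := lift ord0 (lift ord0 ord0).
have sumE (F : 'I_3 -> R) : \sum_i F i = F i0 + F i1 + F i2.
  by rewrite !big_ord_recl big_ord0 addr0 addrA.
move=> w0 wN wx wt; rewrite !sumE => x1 xt.
move: (wx i0) (wx i1) (wx i2) (wt i0) (wt i1) (wt i2); rewrite !sumE !w0.
rewrite (wN i1 i0) (wN i2 i0) (wN i2 i1).
set a := w i0 i1; set b := w i0 i2; set c := w i1 i2.
pose q := t i0 * t i0 + t i1 * t i1 + t i2 * t i2; rewrite -/q.
move=> e0 e1 e2 f0 f1 f2.
pose s := c * x i0 - b * x i1 + a * x i2.
(* With v = (c, -b, a) one has v × t = - w t, and the identity is (v.x)(t.t) = (v.t)(x.t) + (v ×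
   t).(x × t). *)
have sq : s * q = 0.
  have -> : s * q = (c * t i0 - b * t i1 + a * t i2) *
        (x i0 * t i0 + x i1 * t i1 + x i2 * t i2)
      - ((0 * t i0 + a * t i1 + b * t i2) * (x i1 * t i2 - x i2 * t i1)
       + (- a * t i0 + 0 * t i1 + c * t i2) * (x i2 * t i0 - x i0 * t i2)
       + (- b * t i0 + - c * t i1 + 0 * t i2) * (x i0 * t i1 - x i1 * t i0)).
    by rewrite /s /q; ring.
  by rewrite f0 f1 f2 xt; ring.
(* This and the next two facts are the components of |x|^2 v = (v.x) x - x × (w x), multiplied by
   [q]. *)
have qc : q * c = 0.
  have -> : q * c = q * c * (1 - (x i0 * x i0 + x i1 * x i1 + x i2 * x i2))
      + x i0 * (s * q)
      - q * (x i1 * (- b * x i0 + - c * x i1 + 0 * x i2)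
           - x i2 * (- a * x i0 + 0 * x i1 + c * x i2)).
    by rewrite /s; ring.
  by rewrite x1 sq e1 e2; ring.
have qb : q * b = 0.
  have -> : q * b = q * b * (1 - (x i0 * x i0 + x i1 * x i1 + x i2 * x i2))
      - x i1 * (s * q)
      + q * (x i2 * (0 * x i0 + a * x i1 + b * x i2)
           - x i0 * (- b * x i0 + - c * x i1 + 0 * x i2)).
    by rewrite /s; ring.
  by rewrite x1 sq e0 e2; ring.
have qa : q * a = 0.
  have -> : q * a = q * a * (1 - (x i0 * x i0 + x i1 * x i1 + x i2 * x i2))
      + x i2 * (s * q)
      - q * (x i0 * (- a * x i0 + 0 * x i1 + c * x i2)
           - x i1 * (0 * x i0 + a * x i1 + b * x i2)).
    by rewrite /s; ring.
  by rewrite x1 sq e0 e1; ring.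
have ord3 i : [\/ i = i0, i = i1 | i = i2].
  case: i => [[|[|[|//]]] i3]; [apply: Or31|apply: Or32|apply: Or33]; exact/val_inj.
move=> i j; case: (ord3 i) => ->; case: (ord3 j) => ->;
  by rewrite ?w0 ?mulr0// 1?(wN i1 i0) 1?(wN i2 i0) 1?(wN i2 i1) ?mulrN ?qa ?qb ?qc ?oppr0.
Qed.

(** * Scalar curvature with a parallel unit field *)

Section ParallelUnit.
Context {R : realType} {n : nat} {M : smoothManifold R n}.
Variables (g : riemannian_metric M) (D : vfield M -> vfield M -> vfield M).
Hypothesis hD : is_levi_civita g D.
Variable xi : vfield M.
Hypotheses (xi_unit : g xi xi = 1) (xi_parallel : forall U, D U xi = 0).

(** The correction to the curvature contributes (n - 1) g(E_i,xi)^2 for each i, and these squares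
    sum to g(xi,xi) = 1. The frame is returned for later computations at [p]. *)
Lemma semisym_scalar_curvature (r : M -> R) (p : M) :
  is_scalar_curvature g (semisym_nonmetric g D xi) r ->
  exists E : 'I_n -> vfield M, [/\ tangent_basis E p,
    forall i j, g (E i) (E j) p = (i == j)%:R &
    r p = \sum_i \sum_j g (curvature D (E j) (E i) (E i)) (E j) p + n%:R - 1].
Proof.
case=> S hS /(_ p)[E [basE orthE ->]]; exists E; split=> //.
have n1 : \sum_i g (E i) xi p * g (E i) xi p = 1.
  under eq_bigr do rewrite (metric_sym g (E _)).
  by rewrite -(parseval basE orthE) xi_unit CinfE.
rewrite -addrA -[n%:R - 1]mulr1 -[X in _ * X]n1 mulr_sumr -big_split /=.
apply: eq_bigr => i _.
rewrite (trace_orthonormal basE orthE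
  (semisym_curvature_tensorial hD xi_parallel (E i) (E i)) (hS _ _ _)) /=.
under eq_bigr => j _.
  rewrite (semisym_curvature hD xi_parallel) metricDl CinfE.
  rewrite [X in _ + X](_ : _ = g (E i) xi p * g (E i) xi p
     - g (E i) xi p * (g (E j) xi p * g (E i) (E j) p)); last first.
    by rewrite !metricE !CinfE (orthE j j) eqxx mulr1n; ring.
  over.
rewrite big_split /= sumrB sumr_const card_ord -mulr_sumr; congr (_ + _).
rewrite (bigD1 i)//= orthE eqxx big1 ?addr0; last first.
  by move=> j /negPf ji; rewrite orthE eq_sym ji mulr0.
by rewrite mulr1n -mulr_natl; ring.
Qed.

(** Summing over the frame gives a (n - 1) = 0. *)
Lemma unit_orthogonal_complement (E : 'I_n -> vfield M) (p : M) (a : R) :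
  (1 < n)%N -> tangent_basis E p ->
  (forall i j, g (E i) (E j) p = (i == j)%:R) ->
  (forall V, a * (g V V p - g V xi p * g V xi p) = 0) -> a = 0.
Proof.
move=> n_gt1 basE orthE aV.
have : \sum_i a * (g (E i) (E i) p - g (E i) xi p * g (E i) xi p) = 0.
  by rewrite big1.
rewrite -mulr_sumr sumrB.
under [X in _ - X]eq_bigr do rewrite (metric_sym g (E _)).
rewrite -(parseval basE orthE) xi_unit CinfE.
under eq_bigr do rewrite orthE eqxx.
rewrite sumr_const card_ord => /eqP; rewrite mulf_eq0 => /orP[/eqP//|].
by rewrite subr_eq0 (eqr_nat R n 1) gtn_eqF.
Qed.

End ParallelUnit.

(** For fixed i and j, g(R(E_j,E_i)E_k,E_l) is an antisymmetric matrix in (k,l) whose kernel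
    contains the coordinates of [xi] and [T], so [antisym3_kernel] applies to each summand. *)
Lemma semisym_scalar_curvature3 (R : realType) (M : smoothManifold R 3)
    (g : riemannian_metric M) (D : vfield M -> vfield M -> vfield M)
    (xi T : vfield M) (r : M -> R) :
  is_levi_civita g D -> g xi xi = 1 -> (forall U, D U xi = 0) ->
  g xi T = 0 -> (forall U V, curvature D U V T = 0) ->
  is_scalar_curvature g (semisym_nonmetric g D xi) r ->
  forall p, g T T p * (r p - 2) = 0.
Proof.
move=> hD xi_unit xi_parallel xiT RT hr p.
have [E [basE orthE ->]] := semisym_scalar_curvature hD xi_unit xi_parallel p hr.
rewrite (_ : _ - 2 = \sum_i \sum_j g (curvature D (E j) (E i) (E i)) (E j) p);
  last by ring.
rewrite mulr_sumr big1// => i _; rewrite mulr_sumr big1// => j _.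
rewrite (parseval basE orthE T).
apply: (@antisym3_kernel _ (fun k l => g (curvature D (E j) (E i) (E k)) (E l) p)
  (fun k => g xi (E k) p) (fun k => g T (E k) p)) => [k|k l|k|k||].
- have := curvature_metric hD (E j) (E i) (E k) (E k).
  by move/(congr1 (fun u : Cinf M => u p)); rewrite CinfE; lra.
- by rewrite (curvature_metric hD) CinfE.
- rewrite -(parseval basE orthE) (curvature_metric hD).
  by rewrite (curvature_parallel hD xi_parallel) metric0l oppr0 CinfE.
- by rewrite -(parseval basE orthE) (curvature_metric hD) RT metric0l oppr0 CinfE.
- by rewrite -(parseval basE orthE) xi_unit CinfE.
- by rewrite -(parseval basE orthE) xiT CinfE.
Qed.

(** * Gradient Yamabe solitons in dimension three *)

Theorem theorem5p1 (R : realType) (N : smoothManifold R 3)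
  (g : riemannian_metric N)
  (nabla : vfield N -> vfield N -> vfield N)
  (hnabla : is_levi_civita g nabla)
  (xi : vfield N)
  (xi_unit : g xi xi = 1)
  (xi_parallel : forall U : vfield N, nabla U xi = 0)
  (f : Cinf N) (Df : vfield N) (r : N -> R) (lambda : R)
  (hsol : gradient_yamabe_soliton g (semisym_nonmetric g nabla xi)
            f Df r lambda) :
  (exists c : R, forall p : N, r p = c) \/ trivial_soliton g f Df.
Proof.
have [_ hr sol] := hsol.
pose h := g (nabla xi Df) xi; pose a := g Df xi.
have cD := levi_civita_connection hnabla.
have perp (u : Cinf N) : (forall V, u * (g V V - g V xi * g V xi) = 0) -> u = 0.
  move=> uV; apply/CinfP => p.
  have [E [basE orthE _]] := semisym_scalar_curvature hnabla xi_unit xi_parallel p hr.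
  apply: (unit_orthogonal_complement xi_unit _ basE orthE) => // V.
  by have /(congr1 (fun w : Cinf N => w p)) := uV V; rewrite !CinfE.
(* The pair (xi,xi) determines [r]; substituting it back cancels the term a g(U,Z) and leaves
   [DW]. *)
have rE p : r p = h p + a p + lambda.
  have := sol xi xi p.
  by rewrite /semisym_nonmetric !metricE !CinfE xi_unit !CinfE -/h -/a; lra.
have DW U : nabla U Df = h *: U.
  apply: (@metric_inj _ _ _ g) => Z; apply/CinfP => p.
  have := sol U Z p.
  by rewrite /semisym_nonmetric !metricE !CinfE rE -/a; lra.
clear sol hsol.
have RW U V : curvature nabla U V Df = U h *: V - V h *: U.
  rewrite /curvature !DW !(connection_leibniz cD) -(levi_civita_torsion hnabla).
  by apply/vfieldP => w; rewrite !vfieldE; ring.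
have dh (V : vfield N) : V h = xi h * g V xi.
  have : g (curvature nabla xi V Df) xi = 0.
    by rewrite (curvature_metric hnabla) (curvature_parallel hnabla xi_parallel) metric0l oppr0.
  by rewrite RW !metricE xi_unit mulr1 => /eqP; rewrite subr_eq0 => /eqP ->.
have xih : xi h = 0.
  apply: perp => V.
  (* By pair symmetry this is g(R(Df,V)xi,V). *)
  have : g (curvature nabla xi V Df) V = 0.
    by rewrite (curvature_pair hnabla) (curvature_parallel hnabla xi_parallel) metric0l.
  by rewrite RW !metricE (dh V) (metric_sym g xi V) => <-; ring.
have {xih}dh0 (V : vfield N) : V h = 0 by rewrite dh xih mul0r.
have da (U : vfield N) : U a = h * g U xi.
  by rewrite /a (derive_parallel hnabla xi_parallel) DW metricZl.
pose T : vfield N := Df - a *: xi.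
have gT Z : g Z T = g Z Df - a * g Z xi by rewrite /T !metricE.
have xiT : g xi T = 0 by rewrite gT xi_unit (metric_sym g xi) -/a; ring.
have DT U : nabla U T = h *: (U - g U xi *: xi).
  rewrite /T (connection_add cD) (connNr hnabla) (connection_leibniz cD).
  by rewrite xi_parallel DW da; apply/vfieldP => w; rewrite !vfieldE; ring.
have RT U V : curvature nabla U V T = 0.
  apply: (@metric_inj _ _ _ g) => Z; rewrite (curvature_metric hnabla).
  have RW0 : curvature nabla U V Df = 0 by rewrite RW !dh0 !scale0r subrr.
  have := curvature_metric hnabla U V Z Df.
  have := curvature_metric hnabla U V Z xi.
  rewrite RW0 (curvature_parallel hnabla xi_parallel) !metric0l oppr0.
  by rewrite gT => -> ->; ring.
pose q := g T T.
have dq (U : vfield N) : U q = 2%:R * h * g U T.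
  rewrite /q (levi_civita_metric hnabla) (metric_sym g T) DT metricZl metricDl metricNl metricZl xiT; ring.
have qr : q * (h + a + (lambda - 2) *: (1 : Cinf N)) = 0.
  apply/CinfP => p; rewrite !CinfE Cinf_cstE.
  have := semisym_scalar_curvature3 hnabla xi_unit xi_parallel xiT RT hr p.
  by rewrite rE -/q => <-; ring.
(* Along [xi], [h] and [q] are constant while [a] has derivative [h]. *)
have hq : h * q = 0.
  have := congr1 (vfield_fun xi) qr; rewrite vfield_fM !vfield_fD vfield_cst vfield_f0.
  by rewrite dq dh0 da xiT xi_unit => <-; ring.
have h2T U : h * h * g U T = 0.
  have := congr1 (vfield_fun U) hq; rewrite vfield_fM dh0 dq vfield_f0 => e.
  (* The factor 2 is cancelled pointwise, in the field [R]. *)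
  apply/CinfP => p; have := congr1 (fun w : Cinf N => w p) e.
  by rewrite -[2%:R]/(1 + 1) !CinfE; lra.
(* Differentiating [h2T V] along V, the term with g(nabla_V V,T) vanishes by [h2T] again; the other
   is h^3 (g(V,V) - g(V,xi)^2). *)
have h3 : h * h * h = 0.
  apply: perp => V; have := congr1 (vfield_fun V) (h2T V).
  rewrite !vfield_fM !dh0 vfield_f0 (levi_civita_metric hnabla) mulrDr h2T.
  have -> : g V (nabla V T) = h * (g V V - g V xi * g V xi).
    by rewrite DT !metricE.
  by move=> <-; ring.
have h0 : h = 0.
  apply/CinfP => p; have := congr1 (fun w : Cinf N => w p) h3.
  by rewrite !CinfE => /eqP; rewrite !mulf_eq0 !orbb => /eqP.
right; right => U V.
rewrite (levi_civita_metric hnabla) -!(levi_civita_torsion hnabla).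
by rewrite !DW h0 !scale0r !subr0.
Qed.
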